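(* Let $L/K$ be a finite Galois extension of local fields or of global fields (of any characteristic) with nonabelian Galois group $G$, and let $\mathfrak{B}$ be a $G$-stable fractional ideal of $L$. Then $\mathfrak{B}$ is free over its associated order $\mathfrak{A}_{K[G]}=\{z\in K[G] : z(\mathfrak{B})\subseteq \mathfrak{B}\}$ in $K[G]$ if and only if $\mathfrak{B}$ is free over its associated order $\mathfrak{A}_{\lambda}=\{h\in H_\lambda : h\cdot \mathfrak{B}\subseteq \mathfrak{B}\}$ in $H_\lambda$.
   Context: $K[G]$ acts on $L$ in the usual way via the Galois action. Let $\lambda: G\to \mathrm{Perm}(G)$ be the left regular embedding, $\lambda(g)(h)=gh$. The group $G$ acts on the group algebra $L[\lambda(G)]$ by $\sigma\big(\sum_{g} c_g\lambda(g)\big)=\sum_g \sigma(c_g)\lambda(\sigma g\sigma^{-1})$ ($c_g\in L$). Let $H_\lambda=L[\lambda(G)]^G$ be the fixed subalgebra; this is the Hopf algebra of the canonical nonclassical Hopf–Galois structure on $L/K$ (corresponding, by Greither–Pareigis, to the regular subgroup $\lambda(G)$ of $\mathrm{Perm}(G)$). It acts on $L$ by $\big(\sum_g c_g\lambda(g)\big)\cdot x=\sum_g c_g\, g^{-1}(x)$, i.e. $\sum_\eta c_\eta \eta\cdot x=\sum_\eta c_\eta\,\eta^{-1}(1_G)[x]$. Fractional ideals and associated orders are taken with respect to the ring of integers $\mathfrak{O}_K$ of $K$ and $\mathfrak{O}_L$ of $L$. *)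

(* Defs.v *)
(* MathComp, with Prop-valued sets from mathcomp-classical *)
From HB Require Import structures.
From mathcomp Require Import all_boot all_order all_algebra all_fingroup.
From mathcomp Require Import all_solvable all_field.
From mathcomp Require Import classical_sets.

Set Implicit Arguments.
Unset Strict Implicit.
Unset Printing Implicit Defensive.

Import Order.TTheory GRing.Theory Num.Theory.
Local Open Scope classical_set_scope.
Local Open Scope ring_scope.

(* A valuation is a function v : F -> int whose value at 0 is irrelevant;
   val_ge v n x says v(x) >= n, with the convention v(0) = +oo. *)
Definition val_ge (F : fieldType) (v : F -> int) (n : int) (x : F) : Prop :=
  x = 0 \/ n <= v x.

Definition valuation_ring (F : fieldType) (v : F -> int) : set F :=
  [set x | val_ge v 0 x].

(* Nonarchimedean local field: complete for a normalized discrete valuation,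
   with finite residue field (finitely many classes modulo the maximal ideal). *)
Record local_field (F : fieldType) (v : F -> int) : Prop := LocalField {
  valuationM : forall x y : F, x != 0 -> y != 0 -> v (x * y) = v x + v y;
  valuationD : forall x y : F, x != 0 -> y != 0 -> x + y != 0 ->
    Num.min (v x) (v y) <= v (x + y);
  valuation_surj : forall n : int, exists2 x : F, x != 0 & v x = n;
  valuation_complete : forall u : nat -> F,
    (forall N : int, exists n0 : nat, forall m n : nat,
       (n0 <= m)%N -> (n0 <= n)%N -> val_ge v N (u m - u n)) ->
    exists l : F, forall N : int, exists n0 : nat, forall n : nat,
       (n0 <= n)%N -> val_ge v N (u n - l);
  finite_residue_field : exists s : seq F,
    forall x : F, valuation_ring v x -> exists2 y : F, y \in s & val_ge v 1 (x - y)
}.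

Definition frac_image (R : idomainType) (F : fieldType) (iota : R -> F) : set F :=
  [set x | exists a b : R, b != 0 /\ x = iota a / iota b].

(* iota embeds R in F, and F has finite degree over the fraction field of R. *)
Definition finite_over_frac (R : idomainType) (F : fieldType)
    (iota : {rmorphism R -> F}) : Prop :=
  injective iota /\
  exists (n : nat) (b : 'I_n -> F), forall x : F,
    exists2 c : 'I_n -> F,
      (forall j, frac_image iota (c j)) & x = \sum_(j < n) c j * b j.

(* L/K is an extension of local fields or of global fields, and OL is the ring
   of integers of L. A finite extension of a global field is global, so only K
   is constrained in the global cases.
   - Local: K and L carry compatible valuations (e is the ramification index).
   - Number fields: K is finite over Q and OL is the integral closure of Z.
   - Function fields: K is finite over F_q(t), where F_q[t] -> K is an arbitrary
     embedding, i.e. an embedding of F_q and a transcendental t; OL is the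
     integral closure of F_q[t]. As t varies this gives every ring of
     S-integers, S being the places of K above t = oo. *)
Inductive arithmetic_extension (K : fieldType) (L : fieldExtType K) :
    set L -> Prop :=
  | LocalExtension (vK : K -> int) (vL : L -> int) (e : nat) :
      local_field vK -> local_field vL -> (0 < e)%N ->
      (forall x : K, x != 0 -> vL x%:A = vK x *+ e) ->
      arithmetic_extension (valuation_ring vL)
  | NumberFieldExtension :
      finite_over_frac (intr : {rmorphism int -> K}) ->
      arithmetic_extension (integralOver (intr : int -> L))
  | FunctionFieldExtension (Fq : finFieldType)
      (iota : {rmorphism {poly Fq} -> K}) :
      finite_over_frac iota ->
      arithmetic_extension (integralOver (fun p : {poly Fq} => (iota p)%:A : L)).

Definition fractional_ideal (F : fieldType) (O I : set F) : Prop :=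
  [/\ (exists2 x, I x & x != 0),
      (forall x y, I x -> I y -> I (x + y)),
      (forall a x, O a -> I x -> I (a * x)) &
      exists d, [/\ O d, d != 0 & forall x, I x -> O (d * x)]].

(* gal_of {:L} is the type of all K-automorphisms of L. *)
Definition galois_stable (K : fieldType) (L : splittingFieldType K)
    (B : set L) : Prop :=
  forall (g : gal_of {:L}) (x : L), B x -> B (g x).

(* The action of K[G] on L; z represents the element sum_g z(g) g. *)
Definition group_algebra_act (K : fieldType) (L : splittingFieldType K)
    (z : {ffun gal_of {:L} -> K}) (x : L) : L :=
  \sum_(g : gal_of {:L}) z g *: g x.

(* The group law of gal_of is (g * h) a = h (g a) (galM), the reverse of
   composition, so the composite g o h is h * g. *)
Definition left_regular (K : fieldType) (L : splittingFieldType K)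
    (g : gal_of {:L}) : {perm gal_of {:L}} :=
  perm (@mulIg _ g).

Definition left_regular_image (K : fieldType) (L : splittingFieldType K) :
    {set {perm gal_of {:L}}} :=
  left_regular (L := L) @: [set: gal_of {:L}]%SET.

(* The action of G on L[Perm(G)]: s sends sum_eta c(eta) eta to
   sum_eta s(c(eta)) lambda(s) o eta o lambda(s)^-1. Products of permutations
   also compose from left to right, so the conjugate is eta ^ lambda(s); on
   eta = lambda(g) it is lambda(s o g o s^-1). *)
Definition perm_algebra_conj (K : fieldType) (L : splittingFieldType K)
    (s : gal_of {:L}) (c : {ffun {perm gal_of {:L}} -> L}) :
    {ffun {perm gal_of {:L}} -> L} :=
  [ffun eta => s (c (eta ^ (left_regular s)^-1)%g)].

(* H_lambda = L[lambda(G)]^G, with L[lambda(G)] the elements of L[Perm(G)]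
   supported on lambda(G). *)
Definition H_lambda (K : fieldType) (L : splittingFieldType K) :
    set {ffun {perm gal_of {:L}} -> L} :=
  [set c : {ffun {perm gal_of {:L}} -> L} |
     (forall eta, eta \notin left_regular_image L -> c eta = 0) /\
     (forall s, perm_algebra_conj s c = c)].

Arguments H_lambda {K} L _.

Definition perm_algebra_act (K : fieldType) (L : splittingFieldType K)
    (c : {ffun {perm gal_of {:L}} -> L}) (x : L) : L :=
  \sum_(eta : {perm gal_of {:L}}) c eta * (eta^-1%g 1%g) x.

Definition associated_order (H V : Type) (act : H -> V -> V)
    (H0 : set H) (B : set V) : set H :=
  [set h | H0 h /\ forall x, B x -> B (act h x)].

(* B has a basis X over A, where A acts through act. *)
Definition free_over (H V : zmodType) (act : H -> V -> V)
    (A : set H) (B : set V) : Prop :=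
  exists X : set V,
    [/\ X `<=` B,
        (forall b, B b -> exists (s : seq V) (a : V -> H),
           [/\ uniq s, {in s, forall x, X x}, {in s, forall x, A (a x)} &
               b = \sum_(x <- s) act (a x) x]) &
        (forall (s : seq V) (a : V -> H),
           uniq s -> {in s, forall x, X x} -> {in s, forall x, A (a x)} ->
           \sum_(x <- s) act (a x) x = 0 -> {in s, forall x, a x = 0})].

(* Main.v *)
Require Import Defs.
From HB Require Import structures.
From mathcomp Require Import all_boot all_order all_algebra all_fingroup.
From mathcomp Require Import all_solvable all_field.
From mathcomp Require Import boolp classical_sets.

Set Implicit Arguments.
Unset Strict Implicit.
Unset Printing Implicit Defensive.

Import Order.TTheory GRing.Theory Num.Theory.
Local Open Scope classical_set_scope.
Local Open Scope ring_scope.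

(* Both K[G] and H_lambda act on L through the twisted group algebra L o G, as
   the coefficient functions with values in K, respectively those that are
   G-equivariant for conjugation on G, and the two actions commute. An element x
   generates L freely over one of them exactly when the matrix (s (t x))_(s,t)
   is invertible, a condition that does not see which algebra was used. By
   clearing denominators, B free over an associated order means B = A x for one
   such x. If h in the other algebra sends x into B = A x, then it sends
   B = A x into A (h x), hence into B, so h lies in the other associated order,
   and x generates B over that order too. *)

(** * Denominators with respect to rings of integers *)

Lemma common_frac_denominator (R : idomainType) (K : fieldType)
    (iota : {rmorphism R -> K}) (I : finType) (a : I -> K) :
    injective iota -> (forall i, frac_image iota (a i)) ->
  exists2 r, r != 0 & exists p : I -> R, forall i, iota r * a i = iota (p i).
Proof.
move=> iota_inj afrac.
have /choice[pq pqP] : forall i, exists pq : R * R,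
    pq.2 != 0 /\ a i = iota pq.1 / iota pq.2.
  by move=> i; have [p [q ?]] := afrac i; exists (p, q).
exists (\prod_i (pq i).2); first by apply/prodf_neq0 => i _; case: (pqP i).
exists (fun i => (pq i).1 * \prod_(j | j != i) (pq j).2) => i.
have [qN0 ->] := pqP i; rewrite (bigD1 i) //= !rmorphM /=.
have {}qN0 : iota (pq i).2 != 0 by rewrite -(rmorph0 iota) (inj_eq iota_inj).
by rewrite mulrC mulrA divfK.
Qed.

(** The generators are the products of a [K]-basis of [L] with generators of [K] over the fraction
    field. *)
Lemma finite_over_frac_span (R : idomainType) (K : fieldType)
    (L : fieldExtType K) (iota : {rmorphism R -> K}) : finite_over_frac iota ->
  exists (I : finType) (w : I -> L), forall x, exists2 a : I -> K,
    (forall i, frac_image iota (a i)) & x = \sum_i a i *: w i.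
Proof.
move=> [_ [n [b bspan]]]; pose e := vbasis {:L}.
exists ('I_(\dim {:L}) * 'I_n)%type, 
  (fun u : 'I_(\dim {:L}) * 'I_n => b u.2 *: e`_u.1) => x.
have /choice[c cP] : forall i, exists c : 'I_n -> K,
    (forall j, frac_image iota (c j)) /\ coord e i x = \sum_(j < n) c j * b j.
  by move=> i; have [c ? ?] := bspan (coord e i x); exists c.
exists (fun u => c u.1 u.2) => [u|]; first by case: (cP u.1).
rewrite [LHS](coord_vbasis (memvf x)).
rewrite -(pair_bigA _ (fun i j => c i j *: (b j *: e`_i))) /=.
apply: eq_bigr => i _; have [_ ->] := cP i; rewrite scaler_suml.
by apply: eq_bigr => j _; rewrite scalerA.
Qed.

(* Multiplication by a multiple of c is given by a matrix over R on generators
   of L over the fraction field, so its characteristic polynomial is monic over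
   R and kills that multiple. *)
Lemma integral_denominator (R : idomainType) (K : fieldType)
    (L : fieldExtType K) (iota : {rmorphism R -> K}) (c : L) :
    finite_over_frac iota ->
  exists2 r, r != 0 &
    integralOver (fun p : R => (iota p)%:A : L) (iota r *: c).
Proof.
move=> fin; have [I [w wspan]] := finite_over_frac_span L fin.
have /choice[a aP] : forall i, exists a : I -> K,
    (forall j, frac_image iota (a j)) /\ c * w i = \sum_j a j *: w j.
  by move=> i; have [a ? ?] := wspan (c * w i); exists a.
have [r r0 [p pE]] : exists2 r, r != 0 & exists p : I * I -> R,
    forall u, iota r * a u.1 u.2 = iota (p u).
  by apply: common_frac_denominator => [|u]; case: fin => // ? _; case: (aP u.1).
(* The indices of [p] are swapped so that the row of generators [w] is an eigenvector, with
   eigenvalue [iota r *: c]. *)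
exists r => //; pose S := \matrix_(k, l < #|I|) p (enum_val l, enum_val k).
exists (char_poly S); first exact: char_poly_monic.
rewrite (map_char_poly (in_alg L \o iota)) -eigenvalue_root_char.
apply/eigenvalueP; exists (\row_k w (enum_val k)).
  apply/rowP=> l; rewrite !mxE -scalerAl; have [_ ->] := aP (enum_val l).
  rewrite scaler_sumr (reindex (@enum_val _ (fun _ : I => true))) /=; last first.
    exact: onW_bij (@enum_val_bij _).
  apply: eq_bigr => k _; rewrite /S !mxE scalerA /= -(pE (_, _)) /=.
  by rewrite mulr_algr.
(* The eigenvector is nonzero, since the [w i] span 1. *)
apply/eqP=> /rowP w0; have [z _ /eqP] := wspan 1; rewrite big1 ?oner_eq0 // => i _.
by have := w0 (enum_rank i); rewrite !mxE enum_rankK => ->; rewrite scaler0.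
Qed.

(** The denominator is sought in [K] because both algebras acting on [L] are closed under scaling by
    [K]. *)
Lemma arithmetic_denominator (K : fieldType) (L : fieldExtType K) (OL : set L)
    (c : L) : arithmetic_extension OL ->
  exists d : K, [/\ d != 0, OL d%:A & OL (d *: c)].
Proof.
case=> [vK vL e lK lL e0 vLK|fin|Fq iota fin].
(* As [e] is at least 1, the valuation of [d] does not drop in [L], so it compensates any pole of
   [c]. *)
- have [d d0 vd] := valuation_surj lK `|vL c|%:Z; exists d.
  have dA0 : d%:A != 0 :> L by rewrite scaler_eq0 oner_eq0 orbF.
  have vdA : `|vL c|%:Z <= vL d%:A.
    by rewrite vLK // vd -mulr_natr ler_peMr // ler1n.
  split=> //; first by right; apply: le_trans vdA.
  have [->|c0] := eqVneq c 0; first by left; rewrite scaler0.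
  right; rewrite -mulr_algl (valuationM lL) //.
  by rewrite -lerBlDr sub0r (le_trans _ vdA) // abszE -normrN ler_norm.
- have [r r0 rint] := integral_denominator c fin; exists r%:~R; split.
  + by case: fin => inj _; rewrite -(rmorph0 (intr : {rmorphism int -> K})) (inj_eq inj).
  + have -> : (r%:~R : K)%:A = r%:~R :> L by rewrite -in_algE rmorph_int.
    exact: (integral_id (intr : {rmorphism int -> L})).
  + suff <- : (fun p : int => (p%:~R : K)%:A : L) = intr by [].
    by apply/funext=> p; rewrite -in_algE rmorph_int.
- have [r r0 rint] := integral_denominator c fin; exists (iota r); split=> //.
  + by case: fin => inj _; rewrite -(rmorph0 iota) (inj_eq inj).
  + exact: (integral_id (in_alg L \o iota)).
Qed.

(** * Transport of freeness between algebras *)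

(** Freeness sees an algebra only through its action and the vanishing of coefficients, and [f]
    respects both. *)
Lemma free_over_transport (V H H' : zmodType) (act : H -> V -> V)
    (act' : H' -> V -> V) (M : set H) (M' : set H') (B : set V) (f : H -> H') :
    (forall h, M h -> M' (f h)) ->
    (forall h', M' h' -> exists2 h, M h & f h = h') ->
    f 0 = 0 -> (forall h, M h -> f h = 0 -> h = 0) ->
    (forall h, M h -> act' (f h) =1 act h) ->
  free_over act (associated_order act M B) B <->
  free_over act' (associated_order act' M' B) B.
Proof.
move=> fM f_onto f0 f_inj actE.
have fA h : associated_order act M B h -> associated_order act' M' B (f h).
  by case=> Mh hB; split=> [|x Bx]; [exact: fM | rewrite actE //; exact: hB].
(* [g] is a section of [f] over the associated order, with default value 0 elsewhere. *)
have /choice[g gP] : forall h', exists h, associated_order act' M' B h' ->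
    associated_order act M B h /\ f h = h'.
  move=> h'; case: (EM (associated_order act' M' B h')) => [[M'h' h'B]|]; last first.
    by exists 0.
  have [h Mh fh] := f_onto _ M'h'; exists h; split=> //; split=> // x Bx.
  by rewrite -actE // fh; exact: h'B.
have gE h' x : associated_order act' M' B h' -> act (g h') x = act' h' x.
  by move=> /gP[[Mg _] fg]; rewrite -actE // fg.
split=> -[X [XB genX freeX]]; exists X; split=> //.
- move=> b /genX[s [a [Us sX sA ->]]]; exists s, (f \o a); split=> //.
    by move=> x xs; apply: fA; exact: sA.
  by apply: eq_big_seq => x xs /=; rewrite actE //; case: (sA x xs).
- move=> s a Us sX sA sum0 x xs; have [_ <-] := gP _ (sA x xs).
  suff -> : g (a x) = 0 by [].
  apply: (freeX s (g \o a)) => // [y ys|]; first by case: (gP _ (sA y ys)).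
  by rewrite -[RHS]sum0; apply: eq_big_seq => y ys; rewrite /= gE //; exact: sA.
- move=> b /genX[s [a [Us sX sA ->]]]; exists s, (g \o a); split=> //.
    by move=> x xs; case: (gP _ (sA x xs)).
  by apply: eq_big_seq => x xs; rewrite /= gE //; exact: sA.
- move=> s a Us sX sA sum0 x xs; apply: f_inj; first by case: (sA x xs).
  apply: (freeX s (f \o a)) => // [y ys|]; first by apply: fA; exact: sA.
  rewrite -[RHS]sum0; apply: eq_big_seq => y ys /=.
  by rewrite actE //; case: (sA y ys).
Qed.

Lemma uniq_constant (T : eqType) (s : seq T) x :
  uniq s -> {in s, forall y, y = x} -> s = [::] \/ s = [:: x].
Proof.
case: s => [|y [|z s]] Us sx; first by left.
  by right; rewrite (sx y) ?mem_head.
have yx := sx y (mem_head _ _).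
have zx : z = x by apply: sx; rewrite !inE eqxx orbT.
by move: Us; rewrite yx zx /= inE eqxx.
Qed.

(** * The twisted group algebra acting on [L] *)

Section Twisted.
Variables (K : fieldType) (L : splittingFieldType K).
Implicit Types (c : {ffun gal_of {:L} -> L}) (g s : gal_of {:L}) (x y : L).

Definition twisted_act c x : L := \sum_g c g * g x.

(* The images of K[G] and of H_lambda. The second one is indexed by the inverse:
   lambda(g^-1) acts on L as g, and c g is the coefficient of lambda(g^-1). *)
Definition scalar_valued : set {ffun gal_of {:L} -> L} :=
  [set c | exists z : gal_of {:L} -> K, forall g, c g = (z g)%:A].

Definition conj_equivariant : set {ffun gal_of {:L} -> L} :=
  [set c | forall s g, s (c g) = c (g ^ s)%g].

Lemma galMx g s x : (g * s)%g x = s (g x).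
Proof. by rewrite galM ?memvf. Qed.

Lemma twisted_actD c x y : twisted_act c (x + y) = twisted_act c x + twisted_act c y.
Proof.
by rewrite -big_split; apply: eq_bigr => g _; rewrite rmorphD mulrDr.
Qed.

Lemma twisted_actZ c a x : twisted_act c (a *: x) = a *: twisted_act c x.
Proof.
by rewrite scaler_sumr; apply: eq_bigr => g _; rewrite linearZ /= scalerAr.
Qed.

Lemma twisted_act0 c : twisted_act c 0 = 0.
Proof. by rewrite -[0 in LHS](scale0r 0) twisted_actZ scale0r. Qed.

Lemma twisted_act0l x : twisted_act 0 x = 0.
Proof. by apply: big1 => g _; rewrite ffunE mul0r. Qed.

Lemma twisted_scale_act a c x : twisted_act (a *: c) x = a *: twisted_act c x.
Proof.
by rewrite scaler_sumr; apply: eq_bigr => g _; rewrite ffunE scalerAl.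
Qed.

Lemma twisted_actBl c c' x :
  twisted_act (c - c') x = twisted_act c x - twisted_act c' x.
Proof.
by rewrite -sumrB; apply: eq_bigr => g _; rewrite !ffunE mulrBl.
Qed.

Lemma twisted_actNl c x : twisted_act (- c) x = - twisted_act c x.
Proof. by rewrite -[- c]add0r twisted_actBl twisted_act0l sub0r. Qed.

Lemma twisted_act_sum c I (r : seq I) (F : I -> L) :
  twisted_act c (\sum_(i <- r) F i) = \sum_(i <- r) twisted_act c (F i).
Proof. exact: (big_morph _ (twisted_actD c) (twisted_act0 c)). Qed.

(** Dedekind's independence of automorphisms. *)
Lemma twisted_act_inj c : (forall x, twisted_act c x = 0) -> c = 0.
Proof.
move=> c0; apply/ffunP=> g; rewrite ffunE.
by apply: (@gal_independent _ _ _ predT) => // a _; exact: c0.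
Qed.

(** Applying [g] and then [s] is applying [s] and then [g ^ s], so reindexing by conjugation absorbs
    [s]. *)
Lemma conj_equivariant_gal c s x : conj_equivariant c ->
  s (twisted_act c x) = twisted_act c (s x).
Proof.
move=> cG; rewrite rmorph_sum /= [RHS](reindex_inj (conjg_inj s)) /=.
apply: eq_bigr => g _; rewrite rmorphM /= cG -!galMx.
by rewrite -conjgC.
Qed.

(** An equivariant operator is [K]-linear and commutes with each automorphism, hence with their
    [K]-combinations. *)
Lemma twisted_act_commute c c' x : scalar_valued c -> conj_equivariant c' ->
  twisted_act c' (twisted_act c x) = twisted_act c (twisted_act c' x).
Proof.
case=> z cE c'G; rewrite [LHS]twisted_act_sum; apply: eq_bigr => g _.
by rewrite conj_equivariant_gal // cE -!scalerAl !mul1r twisted_actZ.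
Qed.

Lemma card_gal_of (galLK : galois 1 {:L}) : #|{: gal_of {:L}}| = \dim {:L}.
Proof.
rewrite -(divn1 (\dim _)) -[X in (_ %/ X)%N](dimv1 L) galois_dim //.
by apply: eq_card => g; rewrite inE gal_kHom ?sub1v // k1AHom.
Qed.

(** * The Galois matrix and free generators of [L] *)

Local Notation ev i :=
  (enum_val (i : 'I_#|{: gal_of {:L}}|) : gal_of {:L}).

Lemma sum_ev (F : gal_of {:L} -> L) :
  \sum_g F g = \sum_(i < #|{: gal_of {:L}}|) F (ev i).
Proof.
rewrite (reindex (fun i : 'I_#|{: gal_of {:L}}| => ev i)) //=.
exact: onW_bij (@enum_val_bij _).
Qed.

(** When [L/K] is Galois, invertibility means that the conjugates of [x] form a normal basis. *)
Definition galois_matrix x : 'M[L]_#|{: gal_of {:L}}| :=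
  \matrix_(i, j) ev i (ev j x).

Lemma mul_galois_matrix (v : 'rV_#|{: gal_of {:L}}|) x g :
  (v *m galois_matrix x) 0 (enum_rank g) =
  twisted_act [ffun h => v 0 (enum_rank h)] (g x).
Proof.
rewrite mxE /twisted_act sum_ev.
by apply: eq_bigr => i _; rewrite mxE ffunE enum_valK enum_rankK.
Qed.

(** The left kernel of the matrix consists of the coefficient functions that kill every conjugate of
    [x]. *)
Lemma galois_matrix_unitP x :
  reflect (forall c, (forall g, twisted_act c (g x) = 0) -> c = 0)
    (galois_matrix x \in unitmx).
Proof.
rewrite unitmxE unitfE; apply: (iffP idP) => [detN0 c c0|inj].
  have cE : c = [ffun g => (\row_i c (ev i)) 0 (enum_rank g)].
    by apply/ffunP=> g; rewrite ffunE mxE enum_rankK.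
  suff v0 : \row_i c (ev i) = 0.
    by rewrite cE; apply/ffunP=> g; rewrite !ffunE v0 mxE.
  apply/eqP; apply: contraNT detN0 => v0; apply/det0P; exists (\row_i c (ev i)) => //.
  by apply/rowP=> j; rewrite -(enum_valK j) mul_galois_matrix -cE c0 mxE.
apply/det0P=> -[v v0 vN]; case/eqP: v0; apply/rowP=> i; rewrite mxE.
have /inj/ffunP/(_ (ev i)) :
    forall g, twisted_act [ffun g => v 0 (enum_rank g)] (g x) = 0.
  by move=> g; rewrite -mul_galois_matrix vN mxE.
by rewrite !ffunE enum_valK.
Qed.

Lemma galois_matrix_solve x y : galois_matrix x \in unitmx ->
  exists c, forall g, twisted_act c (g x) = g y.
Proof.
move=> uN; pose v := (\row_j ev j y) *m invmx (galois_matrix x).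
exists [ffun g => v 0 (enum_rank g)] => g.
by rewrite -mul_galois_matrix mulmxKV // mxE enum_rankK.
Qed.

(** Solve for [c] sending each [g x] to [g y]. The conjugate [d] of [c] by [s] solves the same
    system, so uniqueness makes [c] equivariant. *)
Lemma conj_equivariant_onto x : galois_matrix x \in unitmx ->
  forall y, exists2 c, conj_equivariant c & twisted_act c x = y.
Proof.
move=> uN y; have [c cE] := galois_matrix_solve y uN.
exists c; last by have := cE 1%g; rewrite !gal_id.
have /galois_matrix_unitP inj := uN.
move=> s g; pose d := [ffun g => s (c (g ^ s^-1)%g)].
have /inj/ffunP/(_ (g ^ s)%g) : forall t : gal_of {:L}, twisted_act (d - c) (t x) = 0.
  move=> t; rewrite twisted_actBl cE; apply/eqP; rewrite subr_eq0; apply/eqP.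
  rewrite -[t in RHS](mulgKV s) galMx -cE rmorph_sum /=.
  rewrite [LHS](reindex_inj (conjg_inj s)) /=.
  apply: eq_bigr => h _; rewrite ffunE conjgK rmorphM /= -!galMx.
  by rewrite -!mulgA.
by rewrite !ffunE conjgK => /eqP; rewrite subr_eq0 => /eqP.
Qed.

(** If [c] kills all conjugates of [x], then averaging [a * c] over the group gives an equivariant
    [tr a] that kills [x], so [tr a = 0] for every [a]. *)
Lemma conj_equivariant_unit x :
    (forall c, conj_equivariant c -> twisted_act c x = 0 -> c = 0) ->
  galois_matrix x \in unitmx.
Proof.
move=> inj; apply/galois_matrix_unitP => c c0; apply/ffunP=> g0; rewrite ffunE.
pose tr a := [ffun g => \sum_(s : gal_of {:L}) s (a * c (g ^ s^-1)%g)] : {ffun gal_of {:L} -> L}.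
have tr0 a : tr a = 0.
  apply: inj => [s g|].
    rewrite !ffunE rmorph_sum [RHS](reindex_inj (mulIg s)) /=.
    by apply: eq_bigr => t _; rewrite galMx invMg conjgM conjgK.
  rewrite /twisted_act; under eq_bigr do rewrite ffunE mulr_suml.
  rewrite exchange_big big1 // => s _ /=.
  rewrite (reindex_inj (conjg_inj s)) /=.
  transitivity (s (a * twisted_act c (s^-1%g x))); last by rewrite c0 mulr0 rmorph0.
  rewrite mulr_sumr rmorph_sum /=; apply: eq_bigr => h _.
  by rewrite conjgK !rmorphM /= -mulrA -!galMx.
(* At a fixed [g0], [tr a = 0] is a linear relation between automorphisms evaluated at [a];
   independence kills each coefficient, and [s = 1] gives [c g0]. *)
suff /(_ 1%g isT) : forall s : gal_of {:L}, predT s -> s (c (g0 ^ s^-1)%g) = 0.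
  by rewrite gal_id invg1 conjg1.
apply: gal_independent => a _.
have /ffunP/(_ g0) := tr0 a; rewrite !ffunE => {2}<-.
by apply: eq_bigr => s _; rewrite rmorphM mulrC.
Qed.

(** The conjugates of [x] are independent over [K] and as many as the degree, hence a basis. *)
Lemma scalar_valued_onto (galLK : galois 1 {:L}) x :
    (forall c, scalar_valued c -> twisted_act c x = 0 -> c = 0) ->
  forall y, exists2 c, scalar_valued c & twisted_act c x = y.
Proof.
move=> inj y; pose X := [tuple ev i x | i < #|{: gal_of {:L}}|].
pose z (k : 'I_#|{: gal_of {:L}}| -> K) := [ffun g => (k (enum_rank g))%:A : L].
have zE k : \sum_(i < #|{: gal_of {:L}}|) k i *: X`_i = twisted_act (z k) x.
  rewrite /twisted_act sum_ev.
  apply: eq_bigr => i _.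
  by rewrite ffunE -tnth_nth tnth_mktuple enum_valK mulr_algl.
have zS k : scalar_valued (z k).
  by exists (fun g => k (enum_rank g)) => g; rewrite ffunE.
have freeX : free X.
  apply/freeP=> k; rewrite zE => /(inj _ (zS k))/ffunP z0 i; apply/eqP.
  have := z0 (ev i).
  by rewrite !ffunE enum_valK => /eqP; rewrite scaler_eq0 oner_eq0 orbF.
have /coord_span -> : y \in <<X>>%VS.
  have : basis_of {:L} X.
    by rewrite basisEfree freeX subvf size_tuple card_gal_of /=.
  by move/span_basis=> ->; rewrite memvf.
by exists (z (fun i => coord X i y)); last by rewrite zE.
Qed.

(** A [c] that kills all conjugates of [x] kills their [K]-span, which is [L]. *)
Lemma scalar_valued_unit (galLK : galois 1 {:L}) x :
    (forall c, scalar_valued c -> twisted_act c x = 0 -> c = 0) ->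
  galois_matrix x \in unitmx.
Proof.
move=> inj; apply/galois_matrix_unitP => c c0; apply: twisted_act_inj => y.
have [d [z zE] <-] := scalar_valued_onto galLK inj y.
rewrite {2}/twisted_act twisted_act_sum big1 // => g _.
by rewrite zE mulr_algl twisted_actZ c0 scaler0.
Qed.

(** Automorphisms fix the values of [c], so applying them all to the relation puts the column of [c]
    in the right kernel. *)
Lemma scalar_valued_inj x : galois_matrix x \in unitmx ->
  forall c, scalar_valued c -> twisted_act c x = 0 -> c = 0.
Proof.
move=> uN c [z zE] c0; pose v : 'cV[L]_#|{: gal_of {:L}}| := \col_j c (ev j).
suff v0 : v = 0.
  apply/ffunP=> g; have /colP/(_ (enum_rank g)) := v0.
  by rewrite !mxE enum_rankK ffunE.
rewrite -[v](mulKmx uN); suff -> : galois_matrix x *m v = 0 by rewrite mulmx0.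
apply/colP=> i; rewrite mxE.
transitivity (ev i (twisted_act c x)); last by rewrite c0 rmorph0 mxE.
rewrite rmorph_sum sum_ev.
by apply: eq_bigr => j _; rewrite !mxE zE rmorphM /= rmorph_alg mulrC.
Qed.

Lemma conj_equivariant_inj x : galois_matrix x \in unitmx ->
  forall c, conj_equivariant c -> twisted_act c x = 0 -> c = 0.
Proof.
move=> /galois_matrix_unitP inj c cG c0; apply: inj => g.
by rewrite -conj_equivariant_gal // c0 rmorph0.
Qed.

(** * Freeness over associated orders *)

Section AssociatedOrders.
Variable B : set L.
Let A (M : set {ffun gal_of {:L} -> L}) := associated_order twisted_act M B.

Definition twisted_one : {ffun gal_of {:L} -> L} := [ffun g => (g == 1%g)%:R].

Lemma twisted_act1 x : twisted_act twisted_one x = x.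
Proof.
rewrite /twisted_act (bigD1 1%g) //= ffunE eqxx gal_id mul1r big1 ?addr0 //.
by move=> g g1; rewrite ffunE (negbTE g1) mul0r.
Qed.

(* Clearing denominators turns freeness over the order into freeness over the
   algebra spanned by it, and there the basis has one element because M x is
   already all of L. *)
Lemma free_over_rank1 (M : set {ffun gal_of {:L} -> L}) :
    (forall a c, M c -> M (a *: c)) -> M twisted_one ->
    (forall x, (forall c, M c -> twisted_act c x = 0 -> c = 0) ->
       forall y, exists2 c, M c & twisted_act c x = y) ->
    (exists2 b, B b & b != 0) ->
    (forall c, exists d : K, [/\ d != 0, forall x, B x -> B (d *: x) &
       forall x, B x -> B (d *: twisted_act c x)]) ->
    free_over twisted_act (A M) B ->
  exists x, [/\ B x, forall c, M c -> twisted_act c x = 0 -> c = 0 &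
    forall b, B b -> exists2 c, A M c & twisted_act c x = b].
Proof.
move=> MZ M1 onto [b0 Bb0 b0N0] denom [X [XB genX freeX]].
have [x Xx] : exists x, X x.
  have [[|x s] [a [_ sX _ b0E]]] := genX _ Bb0.
    by move: b0N0; rewrite b0E big_nil eqxx.
  by exists x; apply: sX; rewrite mem_head.
have inj c : M c -> twisted_act c x = 0 -> c = 0.
  move=> Mc c0; have [d [d0 dB dcB]] := denom c.
  suff /eqP : d *: c = 0 by rewrite scaler_eq0 (negbTE d0) => /eqP.
  apply: (freeX [:: x] (fun=> d *: c)) => // [y|y _||]; last exact: mem_head.
  - by rewrite inE => /eqP->.
  - by split=> [|z Bz]; [exact: MZ | rewrite twisted_scale_act; exact: dcB].
  - by rewrite big_seq1 twisted_scale_act c0 scaler0.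
have Xx1 y : X y -> y = x.
  move=> Xy; apply/eqP; apply: contraT => yx.
  have [c Mc cx] := onto x inj y; have [d [d0 dB dcB]] := denom (- c).
  (* If [y = c x], then [d] times [y] minus [d c] times [x] is a relation over the order, whose
     first coefficient is nonzero. *)
  pose a z := if z == y then d *: twisted_one else d *: - c.
  have Uyx : uniq [:: y; x] by rewrite /= inE yx.
  have inX : {in [:: y; x], forall z, X z}.
    by move=> z; rewrite !inE => /orP[]/eqP->.
  have aA : {in [:: y; x], forall z, A M (a z)}.
    move=> z _; rewrite /a; case: ifP => _; split=> [|t Bt].
    - exact: MZ.
    - by rewrite twisted_scale_act twisted_act1; exact: dB.
    - by rewrite -scaleN1r scalerA; exact: MZ.
    - by rewrite twisted_scale_act; exact: dcB.
  have /(freeX _ a Uyx inX aA)/(_ y (mem_head _ _)) :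
      \sum_(z <- [:: y; x]) twisted_act (a z) z = 0.
    rewrite !big_cons big_nil addr0 /a eqxx eq_sym (negbTE yx).
    rewrite !twisted_scale_act twisted_act1 twisted_actNl cx scalerN.
    exact: subrr.
  rewrite /a eqxx => /ffunP/(_ 1%g)/eqP.
  by rewrite !ffunE eqxx scaler_eq0 oner_eq0 orbF (negbTE d0).
exists x; split=> [||b Bb]; [exact: XB | exact: inj |].
have [s [a [Us sX sA ->]]] := genX b Bb.
have [sE|sE] := uniq_constant Us (fun y ys => Xx1 y (sX y ys)); last first.
  exists (a x); last by rewrite sE big_seq1.
  by apply: sA; rewrite sE mem_head.
exists 0; last by rewrite twisted_act0l sE big_nil.
split=> [|y By]; first by rewrite -(scale0r twisted_one); exact: MZ.
(* Clearing the denominators of the zero operator shows that [B] contains 0. *)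
have [d [_ _ /(_ _ By)]] := denom 0.
by rewrite twisted_act0l scaler0.
Qed.

Lemma free_over_exchange (M M' : set {ffun gal_of {:L} -> L}) x :
    (forall c c' y, M c -> M' c' ->
       twisted_act c' (twisted_act c y) = twisted_act c (twisted_act c' y)) ->
    (forall c, M' c -> twisted_act c x = 0 -> c = 0) ->
    (forall y, exists2 c, M' c & twisted_act c x = y) ->
    B x -> (forall b, B b -> exists2 c, A M c & twisted_act c x = b) ->
  free_over twisted_act (A M') B.
Proof.
move=> comm inj onto Bx gen; exists [set x]; split=> [_ -> //|b Bb|s a Us sx sA].
  have [c' M'c' c'x] := onto b.
  exists [:: x], (fun=> c'); split=> // [y|y _|]; last by rewrite big_seq1.
    by rewrite inE => /eqP.
  (* Writing [z = c x] with [c] in the other order, [c' z = c (c' x) = c b] lies in [B]. *)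
  split=> // z /gen[c [Mc cB] <-].
  by rewrite comm // c'x; exact: cB.
have [->|sE] := uniq_constant Us sx; first by [].
rewrite sE big_seq1 => ax0 y; rewrite inE => /eqP ->; apply: inj => //.
by case: (sA x) => //; rewrite sE mem_head.
Qed.

End AssociatedOrders.

(** * Identification of [K[G]] and [H_lambda] in the twisted group algebra *)

Lemma group_algebra_twisted B :
  free_over (@group_algebra_act K L)
    (associated_order (@group_algebra_act K L) setT B) B <->
  free_over twisted_act (associated_order twisted_act scalar_valued B) B.
Proof.
pose f (z : {ffun gal_of {:L} -> K}) := [ffun g => (z g)%:A : L].
apply: (@free_over_transport _ _ _ _ _ _ _ _ f) => [z _|c [z zE]||z _ /ffunP fz0|z _ x].
- by exists z => g; rewrite ffunE.
- by exists (finfun z) => //; apply/ffunP=> g; rewrite !ffunE zE.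
- by apply/ffunP=> g; rewrite !ffunE scale0r.
- apply/ffunP=> g; have /eqP := fz0 g.
  by rewrite !ffunE scaler_eq0 oner_eq0 orbF => /eqP.
- by apply: eq_bigr => g _; rewrite ffunE mulr_algl.
Qed.

Lemma left_regularM g h : left_regular (g * h)%g = (left_regular g * left_regular h)%g.
Proof. by apply/permP=> x; rewrite permM !permE mulgA. Qed.

Lemma left_regularV g : left_regular g^-1%g = (left_regular g)^-1%g.
Proof.
by apply/permP=> x; rewrite permE; apply: (canRL (permK _)); rewrite permE mulgKV.
Qed.

Lemma left_regularJ g h : left_regular (g ^ h)%g = (left_regular g ^ left_regular h)%g.
Proof. by rewrite !conjgE !left_regularM left_regularV. Qed.

Lemma left_regularV1 g : (left_regular g)^-1%g 1%g = g^-1%g.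
Proof. by rewrite -left_regularV permE mul1g. Qed.

Lemma H_lambda_twisted B :
  free_over (@perm_algebra_act K L)
    (associated_order (@perm_algebra_act K L) (H_lambda L) B) B <->
  free_over twisted_act (associated_order twisted_act conj_equivariant B) B.
Proof.
pose f (c : {ffun {perm gal_of {:L}} -> L}) : {ffun gal_of {:L} -> L} :=
  [ffun g => c (left_regular g^-1%g)].
have notin (c : {ffun {perm gal_of {:L}} -> L}) : H_lambda L c -> forall eta, eta \notin left_regular_image L -> c eta = 0.
  by case.
have lr_inj : injective (@left_regular K L).
  by move=> g h gh; apply: invg_inj; rewrite -!left_regularV1 gh.
apply: (@free_over_transport _ _ _ _ _ _ _ _ f) => [c [_ cG]|c cG||c Hc /ffunP fc0|c Hc x].
- move=> s g; rewrite !ffunE -[in RHS](cG s) ffunE; congr (s (c _)).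
  by rewrite -conjVg left_regularJ conjgK.
(* On [eta = left_regular g], [eta^-1 1] is [g^-1], the index at which [c] records this
   coefficient. *)
- exists [ffun eta => if eta \in left_regular_image L then c (eta^-1 1%g)%g else 0].
    split=> [eta /negbTE|s]; first by rewrite ffunE => ->.
    apply/ffunP=> eta; rewrite !ffunE.
    (* Each [left_regular s] normalizes the image, so conjugation preserves the support. *)
    have -> : ((eta ^ (left_regular s)^-1)%g \in left_regular_image L) =
              (eta \in left_regular_image L).
      apply/imsetP/imsetP => -[g _ gE].
        by exists (g ^ s)%g; rewrite ?inE // left_regularJ -gE conjgKV.
      by exists (g ^ s^-1)%g; rewrite ?inE // left_regularJ left_regularV -gE.
    case: ifP => [/imsetP[g _ ->]|_]; last by rewrite rmorph0.
    rewrite -left_regularV -left_regularJ !left_regularV1 cG.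
    by rewrite conjVg conjgKV.
  apply/ffunP=> g; rewrite !ffunE imset_f ?inE //.
  by rewrite left_regularV1 invgK.
- by apply/ffunP=> g; rewrite !ffunE.
- apply/ffunP=> eta; rewrite ffunE.
  have [/imsetP[g _ ->]|/(notin _ Hc) //] := boolP (eta \in left_regular_image L).
  by have := fc0 g^-1%g; rewrite !ffunE invgK.
- rewrite /perm_algebra_act (bigID (mem (left_regular_image L))) /=.
  rewrite [X in _ + X]big1 ?addr0 => [|eta /(notin _ Hc) ->]; last by rewrite mul0r.
  rewrite big_imset /=; last by move=> ? ? _ _; exact: lr_inj.
  rewrite /twisted_act (reindex_inj invg_inj) /=; apply: eq_big => [g|g _].
    by rewrite inE.
  by rewrite ffunE invgK left_regularV1.
Qed.

(** * Common denominators on a fractional ideal *)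

Lemma ideal_common_denominator (OL B : set L) (r : seq L) :
    arithmetic_extension OL -> fractional_ideal OL B ->
  exists d : K, [/\ d != 0, forall x, B x -> B (d *: x) &
    forall a x, a \in r -> B x -> B (d *: a * x)].
Proof.
move=> arith [_ _ BM _]; elim: r => [|c r [d [d0 dB dr]]].
  by exists 1; split=> // [|x]; [exact: oner_neq0 | rewrite scale1r].
have [e [e0 Oe Oec]] := arithmetic_denominator c arith; exists (e * d).
have eB x : B x -> B (e *: x) by move=> Bx; rewrite -mulr_algl; exact: BM.
split=> [|x Bx|a x]; first by rewrite mulf_neq0.
  by rewrite -scalerA; apply: eB; exact: dB.
rewrite inE => /orP[/eqP->|ar] Bx.
  rewrite (mulrC e) -scalerA -scalerAl; apply: dB; exact: BM.
by rewrite -scalerA -scalerAl; apply: eB; exact: dr.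
Qed.

Lemma twisted_denominator (OL B : set L) c :
    arithmetic_extension OL -> fractional_ideal OL B -> galois_stable B ->
  exists d : K, [/\ d != 0, forall x, B x -> B (d *: x) &
    forall x, B x -> B (d *: twisted_act c x)].
Proof.
move=> arith idealB stable.
(* The extra 0 in the list serves to show [B 0], needed to sum inside [B]. *)
have [d [d0 dB dc]] := ideal_common_denominator (0 :: codom c) arith idealB.
exists d; split=> // x Bx; case: idealB => _ BD _ _.
have B0 : B 0 by have := dc 0 x (mem_head _ _) Bx; rewrite scaler0 mul0r.
rewrite -twisted_scale_act; apply: big_ind => // g _; rewrite ffunE.
by apply: dc; [rewrite inE codom_f orbT | exact: stable].
Qed.

End Twisted.

Theorem mainTheorem1 (K : fieldType) (L : splittingFieldType K)
    (OL B : set L)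
    (galLK : galois 1 {:L})
    (nonabelian : ~~ abelian 'Gal({:L} / 1))
    (arithLK : arithmetic_extension OL)
    (idealB : fractional_ideal OL B)
    (stableB : galois_stable B) :
  free_over (@group_algebra_act K L)
            (associated_order (@group_algebra_act K L) setT B) B
  <->
  free_over (@perm_algebra_act K L)
            (associated_order (@perm_algebra_act K L) (H_lambda L) B) B.
Proof.
rewrite group_algebra_twisted H_lambda_twisted.
have B_neq0 : exists2 b, B b & b != 0 by case: idealB.
have denom c := twisted_denominator c arithLK idealB stableB.
split=> free.
- have [||x inj|x [Bx inj gen]] := free_over_rank1 _ _ _ B_neq0 denom free.
  + by move=> a c [z zE]; exists (fun g => a * z g) => g; rewrite ffunE zE scalerA.
  + exists (fun g => (g == 1%g)%:R) => g; rewrite ffunE.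
    by case: eqP; rewrite ?scale1r ?scale0r.
  + exact: scalar_valued_onto.
  (* The invertible matrix carries the generator [x] over to the equivariant side. *)
  have uN := scalar_valued_unit galLK inj.
  apply: (free_over_exchange (@twisted_act_commute _ _) _ _ Bx gen).
    exact: conj_equivariant_inj.
  exact: conj_equivariant_onto.
- have [||x inj|x [Bx inj gen]] := free_over_rank1 _ _ _ B_neq0 denom free.
  + by move=> a c cG s g; rewrite !ffunE linearZ /= cG.
  + move=> s g; rewrite !ffunE rmorph_nat; congr (_%:R).
    by rewrite -(inj_eq (conjg_inj s)) conj1g.
  (* Here surjectivity comes from the matrix, not from a dimension count. *)
  + by apply: conj_equivariant_onto; exact: conj_equivariant_unit.
  have uN := conj_equivariant_unit inj.
  apply: (free_over_exchange (M := conj_equivariant (L := L)) _ _ _ Bx gen).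
  + by move=> c c' y cG c'K; apply/esym/twisted_act_commute.
  + exact: scalar_valued_inj.
  + by apply: scalar_valued_onto => //; exact: scalar_valued_inj.
Qed.
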